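(* Let $H:[0,T]\times\mathbb{R}^N\times\mathbb{R}^N\to\mathbb{R}$ satisfy condition (A) (see context). Then there exist functions $f:[0,T]\times\mathbb{R}^N\times\mathbb{B}\to\mathbb{R}^N$ and $l:[0,T]\times\mathbb{R}^N\times\mathbb{B}\to\mathbb{R}$, where $\mathbb{B}$ is the closed unit ball in $\mathbb{R}^{N+1}$, such that $H(t,x,p)=\sup_{a\in\mathbb{B}}\{\langle p,f(t,x,a)\rangle-l(t,x,a)\}$ for all $t,x,p$, and (R1) $f$ and $l$ are continuous; (R2) for every $R\geq0$ there is an integrable $K_R:[0,T]\to[0,\infty)$ with $|f(t,x,a)-f(t,y,a)|+|l(t,x,a)-l(t,y,a)|\leq K_R(t)|x-y|$ for all $x,y\in\mathbb{B}_R$, $a\in\mathbb{B}$ and a.e. $t\in[0,T]$; (R3) there is an integrable $C:[0,T]\to[0,\infty)$ with $|f(t,x,a)|+|l(t,x,a)|\leq C(t)(1+|x|)$ for all $x\in\mathbb{R}^N$, $a\in\mathbb{B}$ and a.e. $t\in[0,T]$.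
   Context: $\mathbb{B}_R$ is the closed ball of radius $R$ centered at $0$; $\|W\|:=\sup_{\xi\in W}|\xi|$; $H^*(t,x,v)=\sup_p\{\langle v,p\rangle-H(t,x,p)\}$ and $\mathrm{dom}\,H^*(t,x,\cdot)=\{v:H^*(t,x,v)\neq\pm\infty\}$. Conditions: (H1) $H$ continuous in all variables. (H2) $H(t,x,\cdot)$ convex. (H3) for every $R\geq0$ there is $C_R\geq0$ with $|H(t,x,p)-H(t,x,q)|\leq C_R|p-q|$ for $t\in[0,T]$, $x\in\mathbb{B}_R$, all $p,q$. (H4) there is an integrable $c\geq0$ with $|H(t,x,p)-H(t,x,q)|\leq c(t)(1+|x|)|p-q|$ for a.e. $t$, all $x,p,q$. (H5) for every $R\geq0$ there is an integrable $k_R\geq0$ with $|H(t,x,p)-H(t,y,p)|\leq k_R(t)(1+|p|)|x-y|$ for $x,y\in\mathbb{B}_R$, all $p$, a.e. $t$. Condition (A): $H$ satisfies (H1)–(H5) and there is a continuous $\lambda:[0,T]\times\mathbb{R}^N\to[0,\infty)$ with $\|\mathrm{dom}\,H^*(t,x,\cdot)\|\leq\lambda(t,x)$ and $\|H^*(t,x,\mathrm{dom}\,H^*(t,x,\cdot))\|\leq\lambda(t,x)$ for all $t,x$; for every $R\geq0$ there is an integrable $\zeta_R\geq 0$ such that $\lambda(t,\cdot)$ is $\zeta_R(t)$-Lipschitz on $\mathbb{B}_R$ for a.e. $t$; and there is an integrable $\vartheta\geq0$ with $\lambda(t,x)\leq\vartheta(t)(1+|x|)$ for all $x$ and a.e.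 $t$. *)

(* Defs.v *)
From HB Require Import structures.
From mathcomp Require Import all_boot all_order all_algebra.
From mathcomp Require Import all_classical all_reals all_analysis.
Set Implicit Arguments. Unset Strict Implicit. Unset Printing Implicit Defensive.
Import Order.TTheory GRing.Theory Num.Theory.
Import numFieldNormedType.Exports.
Local Open Scope classical_set_scope.
Local Open Scope ring_scope.

Section Defs.
Context {R : realType}.

Definition dot {n : nat} (u v : 'rV[R]_n) : R := \sum_(i < n) u 0 i * v 0 i.
Definition enorm {n : nat} (u : 'rV[R]_n) : R := Num.sqrt (dot u u).

Definition cball {n : nat} (r : R) : set 'rV[R]_n := [set x | enorm x <= r].

Definition tint (T : R) : set R := [set t | 0 <= t <= T].

Definition integrable_nonneg (T : R) (c : R -> R) : Prop :=
  (forall t, tint T t -> 0 <= c t) /\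
  (@lebesgue_measure R).-integrable (tint T) (EFin \o c).

Definition ae_on (T : R) (P : R -> Prop) : Prop :=
  {ae (@lebesgue_measure R), forall t, tint T t -> P t}.

Variable N : nat.
Variable H : R -> 'rV[R]_N -> 'rV[R]_N -> R.

Definition Hstar (t : R) (x v : 'rV[R]_N) : \bar R :=
  ereal_sup [set ((dot v p - H t x p)%:E) | p in [set: 'rV[R]_N]].

Definition domHstar (t : R) (x : 'rV[R]_N) : set 'rV[R]_N :=
  [set v | Hstar t x v \is a fin_num].

Variable T : R.

Definition H1 : Prop :=
  {within [set z : R * 'rV[R]_N * 'rV[R]_N | tint T z.1.1],
     continuous (fun z : R * 'rV[R]_N * 'rV[R]_N => H z.1.1 z.1.2 z.2)}.

Definition H2 : Prop :=
  forall t x, tint T t -> forall (p q : 'rV[R]_N) (s : R), 0 <= s <= 1 ->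
    H t x ((1 - s) *: p + s *: q) <= (1 - s) * H t x p + s * H t x q.

Definition H3 : Prop :=
  forall r : R, 0 <= r -> exists Cr : R, 0 <= Cr /\
    forall t x p q, tint T t -> cball r x ->
      `|H t x p - H t x q| <= Cr * enorm (p - q).

Definition H4 : Prop :=
  exists c : R -> R, integrable_nonneg T c /\
    ae_on T (fun t => forall x p q,
      `|H t x p - H t x q| <= c t * (1 + enorm x) * enorm (p - q)).

Definition H5 : Prop :=
  forall r : R, 0 <= r -> exists k : R -> R, integrable_nonneg T k /\
    ae_on T (fun t => forall x y p, cball r x -> cball r y ->
      `|H t x p - H t y p| <= k t * (1 + enorm p) * enorm (x - y)).

Definition conditionA : Prop :=
  H1 /\ H2 /\ H3 /\ H4 /\ H5 /\
  exists lam : R -> 'rV[R]_N -> R,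
    {within [set z : R * 'rV[R]_N | tint T z.1],
       continuous (fun z : R * 'rV[R]_N => lam z.1 z.2)} /\
    (forall t x, 0 <= lam t x) /\
    (forall t x, tint T t -> forall v, domHstar t x v -> enorm v <= lam t x) /\
    (forall t x, tint T t -> forall v, domHstar t x v ->
        (`|Hstar t x v| <= (lam t x)%:E)%E) /\
    (forall r : R, 0 <= r -> exists zeta : R -> R, integrable_nonneg T zeta /\
      ae_on T (fun t => forall x y, cball r x -> cball r y ->
        `|lam t x - lam t y| <= zeta t * enorm (x - y))) /\
    (exists theta : R -> R, integrable_nonneg T theta /\
      ae_on T (fun t => forall x, lam t x <= theta t * (1 + enorm x))).

End Defs.

(* Main.v *)
Require Import Defs.
From HB Require Import structures.
From mathcomp Require Import all_boot all_order all_algebra.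
From mathcomp Require Import all_classical all_reals all_analysis.
From mathcomp Require Import ring lra.
Import Order.TTheory GRing.Theory Num.Theory.
Import numFieldNormedType.Exports.
Set Implicit Arguments.
Unset Strict Implicit.
Unset Printing Implicit Defensive.
Local Open Scope classical_set_scope.
Local Open Scope ring_scope.

(** The epigraph of [H^*(t,x,.)], truncated at height [lam t x], is a convex
body of [R^(N+1)] contained in the ball of radius [2 lam t x].  Its support
function is [s H(t,x,p/s)] in the direction [(p,-s)] with [s > 0]; it is extended
to the other directions by Lipschitz continuity and by the height [lam], so it
inherits continuity in [(t,x)] and the local Lipschitz bound in [x].

It remains to parametrise convex bodies [K] by points [y], so that the parameter
[y] gives [y] itself when [y] is in [K] and the result is Lipschitz in [y] and in
the support function of [K].  Take the mean of the projections on [K] of the points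
of the cube [y + r [0,1]^n], where [r] is the distance from [y] to [K].  The
residual [z - proj_K z] is the gradient of [d_K(z)^2 / 2], so its mean in a
coordinate direction telescopes to a difference of values of [d_K^2 / (2 r)],
which are Lipschitz in [K] since [d_K = O(r)] on the cube.  The mean is an
ultrafilter limit of means over finite grids, which avoids integrals in several
variables. *)

(** * Euclidean inner product and norm *)

Section Euclidean.
Context {R : realType} {n : nat}.
Implicit Types (u v w : 'rV[R]_n) (c : R).

Lemma dotC u v : dot u v = dot v u.
Proof. by apply: eq_bigr => i _; rewrite mulrC. Qed.

Lemma dotDl u v w : dot (u + v) w = dot u w + dot v w.
Proof. by rewrite -big_split; apply: eq_bigr => i _; rewrite mxE mulrDl. Qed.

Lemma dotZl c u w : dot (c *: u) w = c * dot u w.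
Proof. by rewrite /dot mulr_sumr; apply: eq_bigr => i _; rewrite mxE mulrA. Qed.

Lemma dotDr u v w : dot w (u + v) = dot w u + dot w v.
Proof. by rewrite dotC dotDl !(dotC w). Qed.

Lemma dotZr c u w : dot w (c *: u) = c * dot w u.
Proof. by rewrite dotC dotZl dotC. Qed.

Lemma dotNl u w : dot (- u) w = - dot u w.
Proof. by rewrite -scaleN1r dotZl mulN1r. Qed.

Lemma dotNr u w : dot w (- u) = - dot w u.
Proof. by rewrite dotC dotNl dotC. Qed.

Lemma dot0l w : dot 0 w = 0.
Proof. by rewrite -(scale0r 0) dotZl mul0r. Qed.

Lemma dot0r w : dot w 0 = 0.
Proof. by rewrite dotC dot0l. Qed.

Definition dotE := (dotDl, dotDr, dotNl, dotNr, dotZl, dotZr).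

Lemma dot_ge0 u : 0 <= dot u u.
Proof. by apply: sumr_ge0 => i _; rewrite -expr2 sqr_ge0. Qed.

Lemma enorm_ge0 u : 0 <= enorm u.
Proof. exact: sqrtr_ge0. Qed.

Lemma enorm_sqr u : dot u u = enorm u ^+ 2.
Proof. by rewrite sqr_sqrtr ?dot_ge0. Qed.

Lemma enorm0 : enorm (0 : 'rV[R]_n) = 0.
Proof. by rewrite /enorm dot0l sqrtr0. Qed.

Lemma enormZ c u : enorm (c *: u) = `|c| * enorm u.
Proof.
by rewrite /enorm dotZl dotZr mulrA -expr2 sqrtrM ?sqr_ge0// sqrtr_sqr.
Qed.

Lemma enormN u : enorm (- u) = enorm u.
Proof. by rewrite -scaleN1r enormZ normrN1 mul1r. Qed.

Lemma enormB u v : enorm (u - v) = enorm (v - u).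
Proof. by rewrite -enormN opprB. Qed.

Lemma coord_le_enorm u i : `|u 0 i| <= enorm u.
Proof.
rewrite -(sqrtr_sqr (u 0 i)) ler_wsqrtr// /dot (bigD1 i)//= -expr2 lerDl.
by apply: sumr_ge0 => j _; rewrite -expr2 sqr_ge0.
Qed.

Lemma enorm0_eq0 u : enorm u = 0 -> u = 0.
Proof.
move=> u0; apply/rowP => i; rewrite mxE; apply/eqP.
by rewrite -normr_le0 -u0 coord_le_enorm.
Qed.

(** Cauchy-Schwarz, by expanding the square of [enorm v *: u - enorm u *: v]. *)
Lemma dot_le u v : dot u v <= enorm u * enorm v.
Proof.
have [u0|u0] := eqVneq (enorm u) 0.
  by rewrite (enorm0_eq0 u0) dot0l enorm0 mul0r.
have [v0|v0] := eqVneq (enorm v) 0.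
  by rewrite (enorm0_eq0 v0) dot0r enorm0 mulr0.
have uv : 0 < enorm u * enorm v by rewrite mulr_gt0// lt0r ?u0 ?v0 enorm_ge0.
have := dot_ge0 (enorm v *: u - enorm u *: v).
rewrite !dotE (dotC v u) !enorm_sqr => h.
rewrite -(ler_pM2l uv); nra.
Qed.

Lemma enormD u v : enorm (u + v) <= enorm u + enorm v.
Proof.
rewrite -(@ler_pXn2r _ 2)// ?nnegrE ?enorm_ge0 ?addr_ge0 ?enorm_ge0//.
rewrite -enorm_sqr !dotE (dotC v u) !enorm_sqr; have := dot_le u v; nra.
Qed.

Lemma enorm_triangle u v w : enorm (u - w) <= enorm (u - v) + enorm (v - w).
Proof. by rewrite (le_trans _ (enormD _ _))// addrA subrK. Qed.

Lemma enorm_le_add u v : enorm u <= enorm v + enorm (u - v).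
Proof. by rewrite (le_trans _ (enormD _ _))// addrC subrK. Qed.

Lemma ler_dist_enorm u v : `|enorm u - enorm v| <= enorm (u - v).
Proof.
have /= h1 := enorm_triangle u v 0; have /= h2 := enorm_triangle v u 0.
move: h1 h2; rewrite !subr0 (enormB v u) ler_norml; lra.
Qed.

Lemma enorm_le_sum u : enorm u <= \sum_i `|u 0 i|.
Proof.
rewrite -(@ler_pXn2r _ 2)// ?nnegrE ?enorm_ge0 ?sumr_ge0//.
rewrite -enorm_sqr expr2 /dot mulr_suml; apply: ler_sum => i _.
rewrite (le_trans (ler_norm _))// normrM ler_wpM2l//.
by rewrite (bigD1 i)//= lerDl sumr_ge0.
Qed.

Lemma enorm_le_coord u c : (forall i, `|u 0 i| <= c) -> enorm u <= n%:R * c.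
Proof.
move=> uc; apply: (le_trans (enorm_le_sum u)).
rewrite (le_trans (ler_sum _ (fun i _ => uc i)))//.
by rewrite sumr_const card_ord mulr_natl.
Qed.

Lemma enorm_near u (e : R) : 0 < e -> \forall v \near u, enorm (v - u) < e.
Proof.
(* The ambient topology is that of the sup norm, hence a dimensional factor; [n.+1] also covers
   [n = 0]. *)
move=> e0; have d0 : 0 < e / n.+1%:R by rewrite divr_gt0.
apply/nbhs_ballP; exists (e / n.+1%:R) => //= v [_ uv].
apply: (@le_lt_trans _ _ (n%:R * (e / n.+1%:R))).
  by apply: enorm_le_coord => i; have /ltW := uv 0 i; rewrite !mxE distrC.
by rewrite mulrA ltr_pdivrMr// mulrC ltr_pM2l// ltr_nat.
Qed.

Lemma cvg_dot (T : Type) (F : set_system T) (f g : T -> 'rV[R]_n) u v :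
  Filter F -> (forall i, f t 0 i @[t --> F] --> u 0 i) ->
  (forall i, g t 0 i @[t --> F] --> v 0 i) ->
  dot (f t) (g t) @[t --> F] --> dot u v.
Proof.
move=> FF fu gv.
apply: (@cvg_big R _ +%R _ xpredT) => [|i _]; first exact: add_continuous.
exact: (@cvgM _ _ F).
Qed.

End Euclidean.

(** * Proximal points of Lipschitz convex functions *)

Section Prox.
Context {R : realType}.

(** Lets [s] tend to 0 in an inequality; a positive [x] is refuted at [s = x / (c + x)]. *)
Lemma le0_of_small (x c : R) : (forall s, 0 < s <= 1 -> x <= s * c) -> x <= 0.
Proof.
move=> h; rewrite leNgt; apply/negP => x0.
have c0 : 0 < c by have := h 1 _; rewrite ltr01 lexx => /(_ isT); lra.
have := h (x / (c + x)); rewrite ler_pdivrMr ?addr_gt0// divr_gt0 ?addr_gt0//.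
move=> /(_ ltac:(lra)); rewrite -mulrA ler_pMr// mulrC.
by rewrite ler_pdivlMr ?addr_gt0// mul1r; lra.
Qed.

(** The proximal point [w0] minimises [G] plus half the squared distance to [z]; the conclusion is
    the optimality condition that [z - w0] is a subgradient of [G] at [w0]. *)
Lemma prox_exists (n : nat) (G : 'rV[R]_n -> R) (L : R) (z : 'rV[R]_n) :
  (forall p q s, 0 <= s <= 1 ->
     G ((1 - s) *: p + s *: q) <= (1 - s) * G p + s * G q) ->
  (forall p q, `|G p - G q| <= L * enorm (p - q)) ->
  exists w0, forall w, G w0 + dot (z - w0) (w - w0) <= G w.
Proof.
move=> cvxG lipG.
pose psi w := G w + dot (w - z) (w - z) / 2.
have contG : continuous G.
  move=> w; apply/(@cvgrPdist_lt R R _ (nbhs w)) => e e0.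
  have d0 : 0 < e / (`|L| + 1) by rewrite divr_gt0// ltr_wpDl.
  apply: filterS (enorm_near w d0) => v; rewrite ltr_pdivlMr ?ltr_wpDl//.
  move=> vw; rewrite distrC (le_lt_trans (lipG _ _))//.
  have := enorm_ge0 (v - w); have := ler_norm L; nra.
have psi_cont : continuous psi.
  move=> w; apply: (@cvgD _ R _ (nbhs w) _ G); first exact: contG.
  apply: (@cvgM _ _ (nbhs w)); last exact: cvg_cst.
  have ci i : (w' - z) 0 i @[w' --> w] --> (w - z) 0 i.
    under eq_fun do rewrite !mxE; rewrite !mxE.
    by apply: (@cvgB _ R _ (nbhs w)); [exact: coord_continuous|exact: cvg_cst].
  exact: (@cvg_dot _ _ _ (nbhs w)).
(* Outside this box the distance to [z] exceeds [2 * |L|], so the quadratic term outweighs any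
   decrease of [G]: minimising over the box is enough. *)
pose I i := `[z 0 i - 2 * `|L|, z 0 i + 2 * `|L|]%classic.
pose A := [set w : 'rV[R]_n | forall i, I i (w 0 i)].
have cA : compact A by apply: (@rV_compact _ n I) => i; exact: segment_compact.
have Az : A z.
  by move=> i; rewrite /I/= in_itv/=; have := normr_ge0 L; lra.
have [w0 _ hw0] := @compact_EVT_min _ _ psi A (ex_intro _ z Az) cA
  (continuous_subspaceT psi_cont).
have {}hw0 y : A y -> psi w0 <= psi y by move=> Ay; apply: hw0; rewrite inE.
have min w : psi w0 <= psi w.
  have [/hw0//|/existsNP[i]] := pselect (A w).
  rewrite /I/= in_itv/= => /negP wi.
  have wz : 2 * `|L| < enorm (w - z).
    rewrite (lt_le_trans _ (coord_le_enorm _ i))// !mxE ltNge.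
    by apply: contra wi => /ler_normlP[]; lra.
  apply: (le_trans (hw0 _ Az)).
  rewrite /psi subrr dot0l mul0r addr0 enorm_sqr.
  have := lipG z w; rewrite enormB; have := enorm_ge0 (w - z).
  have := ler_norm (G z - G w); have := normr_ge0 L; have := ler_norm L; nra.
exists w0 => w; rewrite -subr_ge0 -oppr_le0.
(* Minimality against [w0 + s *: (w - w0)] gives the claim up to an error of order [s]. *)
apply: (@le0_of_small _ (dot (w - w0) (w - w0) / 2)) => s /andP[s0 s1].
have := min ((1 - s) *: w0 + s *: w).
have /(_ ltac:(lra)) := cvxG w0 w s.
have -> : (1 - s) *: w0 + s *: w = w0 + s *: (w - w0).
  by rewrite scalerBl scale1r scalerBr addrAC addrA.
rewrite /psi.
have -> : w0 + s *: (w - w0) - z = (w0 - z) + s *: (w - w0) by rewrite addrAC.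
have -> : z - w0 = - (w0 - z) by rewrite opprB.
move: (w0 - z) (w - w0) => a b.
rewrite !dotE (dotC b a) => h1 h2.
rewrite -(ler_pM2l s0); nra.
Qed.

End Prox.

(** * Residuals of projections on convex bodies, and their energies *)

Section Residual.
Context {R : realType} {n : nat}.
Implicit Types (S : 'rV[R]_n -> R) (W : 'rV[R]_n -> 'rV[R]_n) (y z w : 'rV[R]_n).

(** These are the support functions of nonempty convex bodies in the ball of radius [M]. *)
Definition sublinear_bounded S (M : R) :=
  [/\ forall u v, S (u + v) <= S u + S v,
      forall c u, 0 <= c -> S (c *: u) = c * S u &
      forall u, `|S u| <= M * enorm u].

(* [W z = z - proj z], where [proj] is the nearest-point projection on the
   convex body with support function [S]. *)
Definition residual S W := forall z,
  (forall w, dot (z - W z) w <= S w) /\ dot (z - W z) (W z) = S (W z).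

(** Half the squared distance from [z] to the body, with gradient [W z]. *)
Definition energy W z : R := enorm (W z) ^+ 2 / 2.

(** By Moreau's decomposition, the proximal point of the support function at [z] is the residual.
    Homogeneity, tested at [0] and [2 *: w0], turns the subgradient inequality into the equality
    required. *)
Lemma residual_exists S M : sublinear_bounded S M -> exists W, residual S W.
Proof.
move=> [subS homS bndS].
have S0 : S 0 = 0 by rewrite -(scale0r 0) homS// mul0r.
suff /choice[W hW] : forall z, exists w0,
    (forall w, dot (z - w0) w <= S w) /\ dot (z - w0) w0 = S w0 by exists W.
move=> z.
have [||w0 hw0] := @prox_exists R n S M z.
- move=> p q s /andP[s0 s1]; rewrite (le_trans (subS _ _))// !homS//; lra.
- move=> p q; have h1 := subS (p - q) q; have h2 := subS (q - p) p.
  move: h1 h2; rewrite !subrK => h1 h2.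
  have := bndS (p - q); have := bndS (q - p); rewrite (enormB q p).
  have := ler_norm (S (p - q)); have := ler_norm (S (q - p)).
  by move=> h3 h4 h5 h6; rewrite ler_norml; lra.
have eq0 : dot (z - w0) w0 = S w0.
  have := hw0 0; have := hw0 (2 *: w0).
  rewrite S0 homS// sub0r dotNr scaler_nat mulr2n addrK; lra.
exists w0; split=> // w; have := hw0 w; rewrite !dotE -eq0 !dotE; lra.
Qed.

Section One.
Variables (S : 'rV[R]_n -> R) (W : 'rV[R]_n -> 'rV[R]_n).
Hypothesis resW : residual S W.

Lemma residual_eq0 z : (forall w, dot z w <= S w) -> W z = 0.
Proof.
move=> zS; apply: enorm0_eq0; have := zS (W z).
have [_ <-] := resW z; rewrite dotDl dotNl enorm_sqr => h.
have := enorm_ge0 (W z); nra.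
Qed.

(** Each residual is normal to the body at its projection; the two normality inequalities add up. *)
Lemma residual_monotone z z' :
  0 <= dot (W z - W z') ((z - W z) - (z' - W z')).
Proof.
have [h1 e1] := resW z; have [h2 e2] := resW z'.
have := h1 (W z'); have := h2 (W z); rewrite -e1 -e2.
rewrite (dotC (W z - W z')).
move: (z - W z) (z' - W z') => a b; rewrite !dotE; lra.
Qed.

(** [z - z'] is the sum of the differences of residuals and of projections, whose inner product is
    nonnegative; so neither summand is longer than the sum. *)
Lemma residual_nonexpansive z z' : enorm (W z - W z') <= enorm (z - z').
Proof.
rewrite -(@ler_pXn2r _ 2)// ?nnegrE ?enorm_ge0// -!enorm_sqr.
have := residual_monotone z z'.
have -> : z - z' = (W z - W z') + ((z - W z) - (z' - W z')).
  by rewrite [RHS]addrC addrACA subrK -opprD subrK.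
move: (W z - W z') ((z - W z) - (z' - W z')) => a b.
rewrite !dotE (dotC b a); have := dot_ge0 b; lra.
Qed.

Lemma projection_nonexpansive z z' :
  enorm ((z - W z) - (z' - W z')) <= enorm (z - z').
Proof.
rewrite -(@ler_pXn2r _ 2)// ?nnegrE ?enorm_ge0// -!enorm_sqr.
have := residual_monotone z z'.
have -> : z - z' = (W z - W z') + ((z - W z) - (z' - W z')).
  by rewrite [RHS]addrC addrACA subrK -opprD subrK.
move: (W z - W z') ((z - W z) - (z' - W z')) => a b.
rewrite !dotE (dotC b a); have := dot_ge0 a; lra.
Qed.

(** Dual formula for the energy: it is the maximum over [w] of the left side, attained at [w = W z]
    by [energyE]. *)
Lemma energy_ge z w : dot w z - S w - enorm w ^+ 2 / 2 <= energy W z.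
Proof.
have [h _] := resW z; have := h w; rewrite /energy -!enorm_sqr.
have := dot_ge0 (w - W z); rewrite !dotE (dotC z w) (dotC w (W z)); lra.
Qed.

Lemma energyE z : energy W z = dot (W z) z - S (W z) - enorm (W z) ^+ 2 / 2.
Proof.
by have [_ <-] := resW z; rewrite /energy -!enorm_sqr !dotE (dotC z); field.
Qed.

Lemma energy_tangent z z' : dot (W z) (z' - z) <= energy W z' - energy W z.
Proof. have := energy_ge z' (W z); rewrite (energyE z) !dotE; lra. Qed.

(** The upper bound is the tangent inequality with [z] and [z'] exchanged, combined with the
    1-Lipschitz bound on residuals. *)
Lemma energy_expand z z' :
  0 <= energy W z' - energy W z - dot (W z) (z' - z) <= enorm (z' - z) ^+ 2.
Proof.
have h1 := energy_tangent z z'; have h2 := energy_tangent z' z.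
have h3 := dot_le (W z' - W z) (z' - z).
have h4 := residual_nonexpansive z' z; have h5 := enorm_ge0 (z' - z).
move: h2 h3; rewrite -(opprB z' z) dotNr !(dotDl _ _ (z' - z)) dotNl => h2 h3.
apply/andP; split; first lra.
nra.
Qed.

End One.

Section Two.
Variables (S S' : 'rV[R]_n -> R) (W W' : 'rV[R]_n -> 'rV[R]_n) (d : R).
Hypotheses (resW : residual S W) (resW' : residual S' W').
Hypothesis SS' : forall w, `|S w - S' w| <= d * enorm w.

(** Insert the maximiser [W z] for [S] into the dual formula for [S']; only the support functions
    differ. *)
Lemma energy_compare z : energy W z - energy W' z <= d * enorm (W z).
Proof.
have := energy_ge resW' z (W z); rewrite (energyE resW).
have := SS' (W z); rewrite ler_norml; lra.
Qed.

(** With [a] and [b] the two distances, the energies give [(a - b) * (a + b) <= 2 * d * a]. *)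
Lemma residual_norm_compare z : 0 <= d -> enorm (W z) - enorm (W' z) <= 2 * d.
Proof.
move=> d0; have := energy_compare z; rewrite /energy.
have := enorm_ge0 (W z); have := enorm_ge0 (W' z).
move: (enorm _) (enorm _) => b a a0 b0 h; rewrite leNgt; apply/negP => h2.
nra.
Qed.

End Two.
End Residual.

(** * Means over finite grids in the unit cube *)

Section Grid.
Context {R : realType} {n : nat}.
Implicit Types (h : 'rV[R]_n -> R).

(** Lower corners of the cells of side [1 / k.+1], so that [grid_mean] is a Riemann sum over the
    unit cube. *)
Definition grid_point k (phi : {ffun 'I_n -> 'I_k.+1}) : 'rV[R]_n :=
  \row_i ((phi i)%:R / k.+1%:R).

Definition grid_mean k h : R :=
  #|{ffun 'I_n -> 'I_k.+1}|%:R^-1 * \sum_phi h (@grid_point k phi).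

Definition update k (phi : {ffun 'I_n -> 'I_k.+1}) i j : {ffun 'I_n -> 'I_k.+1} :=
  [ffun i' => if i' == i then j else phi i'].

Lemma card_grid_gt0 k : 0 < #|{ffun 'I_n -> 'I_k.+1}|%:R :> R.
Proof. by rewrite ltr0n card_ffun !card_ord expn_gt0. Qed.

Lemma enorm_unit_box (u : 'rV[R]_n) :
  (forall i, 0 <= u 0 i <= 1) -> enorm u <= n%:R.
Proof.
move=> hu; rewrite -(mulr1 n%:R); apply: enorm_le_coord => i.
by have /andP[u0 u1] := hu i; rewrite ger0_norm.
Qed.

Lemma enorm_grid_point k (phi : {ffun 'I_n -> 'I_k.+1}) :
  enorm (grid_point phi) <= n%:R.
Proof.
apply: enorm_unit_box => i; rewrite mxE divr_ge0//=.
by rewrite ler_pdivrMr// mul1r ler_nat ltnW.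
Qed.

Lemma grid_mean_le k h c : (forall u, enorm u <= n%:R -> h u <= c) ->
  grid_mean k h <= c.
Proof.
move=> hc; rewrite /grid_mean mulrC ler_pdivrMr ?card_grid_gt0// mulr_natr.
rewrite -sumr_const; apply: ler_sum => phi _; exact/hc/enorm_grid_point.
Qed.

Lemma grid_mean_ge k h c : (forall u, enorm u <= n%:R -> c <= h u) ->
  c <= grid_mean k h.
Proof.
move=> hc; rewrite /grid_mean mulrC ler_pdivlMr ?card_grid_gt0// mulr_natr.
rewrite -sumr_const; apply: ler_sum => phi _; exact/hc/enorm_grid_point.
Qed.

Lemma grid_meanB k h h' :
  grid_mean k h - grid_mean k h' = grid_mean k (fun u => h u - h' u).
Proof. by rewrite /grid_mean -mulrBr -sumrB. Qed.

Lemma normr_grid_mean_le k h c : (forall u, enorm u <= n%:R -> `|h u| <= c) ->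
  `|grid_mean k h| <= c.
Proof.
move=> hc; rewrite ler_norml grid_mean_ge ?grid_mean_le// => u /hc;
  by rewrite ler_norml => /andP[].
Qed.

Lemma dot_grid_mean k (F : 'rV[R]_n -> 'rV[R]_n) (w : 'rV[R]_n) :
  dot (\row_i grid_mean k (fun u => F u 0 i)) w =
  grid_mean k (fun u => dot (F u) w).
Proof.
rewrite /grid_mean /dot exchange_big mulr_sumr /=; apply: eq_bigr => i _.
by rewrite mxE -mulrA mulr_suml.
Qed.

(* Averaging over the cyclic shifts of the [i]-th index turns the mean over the
   grid into a mean of means along lines in direction [i]. *)
Lemma grid_sum_lines k (g : {ffun 'I_n -> 'I_k.+1} -> R) i :
  k.+1%:R * \sum_phi g phi = \sum_phi \sum_j g (update phi i j).
Proof.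
pose shift (c : 'I_k.+1) phi := update phi i (phi i + c).
have shiftK c : cancel (shift c) (shift (- c)).
  move=> phi; apply/ffunP => i'; rewrite !ffunE eqxx.
  by case: eqP => [->|//]; rewrite addrK.
transitivity (\sum_(c < k.+1) \sum_phi g phi).
  by rewrite sumr_const card_ord mulr_natl.
transitivity (\sum_(c < k.+1) \sum_phi g (shift c phi)).
  by apply: eq_bigr => c _; rewrite (reindex_inj (can_inj (shiftK c))).
rewrite exchange_big; apply: eq_bigr => phi _.
by rewrite [RHS](reindex_inj (addrI (phi i))).
Qed.

(** Reduces a bound on the mean to bounds along lines in direction [i], where sums of gradients
    telescope. *)
Lemma normr_grid_mean_lines k h i (B : R) :
  (forall phi : {ffun 'I_n -> 'I_k.+1},
     `|\sum_j h (grid_point (update phi i j))| <= k.+1%:R * B) ->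
  `|grid_mean k h| <= B.
Proof.
move=> hB; rewrite /grid_mean normrM normfV mulrC.
rewrite (ger0_norm (ltW (card_grid_gt0 k))).
rewrite ler_pdivrMr ?card_grid_gt0//.
rewrite -(@ler_pM2l _ k.+1%:R)// -[X in X * _ <= _]ger0_norm// -normrM.
rewrite (grid_sum_lines (fun phi => h (grid_point phi)) i).
apply: (le_trans (ler_norm_sum _ _ _)).
by rewrite mulrA mulr_natr -sumr_const; exact: ler_sum.
Qed.

End Grid.

(** * Smoothed projections and their dependence on the body *)

Section Selection.
Context {R : realType} {n : nat}.
Implicit Types (S : 'rV[R]_n -> R) (W : 'rV[R]_n -> 'rV[R]_n) (y z w : 'rV[R]_n).

Lemma dot_delta (w : 'rV[R]_n) i : dot w (delta_mx 0 i) = w 0 i.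
Proof.
rewrite /dot (bigD1 i)//= !mxE !eqxx mulr1 big1 ?addr0// => j ji.
by rewrite !mxE eqxx (negbTE ji) mulr0.
Qed.

Lemma enorm_delta i : enorm (delta_mx 0 i : 'rV[R]_n) = 1.
Proof. by rewrite /enorm dot_delta mxE !eqxx sqrtr1. Qed.

Section TwoBodies.
Variables (S S' : 'rV[R]_n -> R) (W W' : 'rV[R]_n -> 'rV[R]_n) (d r : R).
Variable y : 'rV[R]_n.
Hypotheses (resW : residual S W) (resW' : residual S' W') (d0 : 0 <= d).
Hypothesis SS' : forall w, `|S w - S' w| <= d * enorm w.
Hypotheses (Wr : enorm (W y) <= r) (Wr' : enorm (W' y) <= r).

(** Both residuals are at most [r] at [y] and 1-Lipschitz, hence at most [(1 + n) * r] at [z]. This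
    factor [r] cancels when the telescoped sum is divided by the step length. *)
Lemma energy_close (z : 'rV[R]_n) : enorm (z - y) <= n%:R * r ->
  `|energy W z - energy W' z| <= d * ((1 + n%:R) * r).
Proof.
move=> zy.
have h1 := energy_compare resW resW' SS' z.
have S'S w : `|S' w - S w| <= d * enorm w by rewrite distrC.
have h2 := energy_compare resW' resW S'S z.
have b1 : enorm (W z) <= (1 + n%:R) * r.
  have h := le_trans (residual_nonexpansive resW z y) zy.
  apply: (le_trans (enorm_le_add _ (W y))); have := Wr; lra.
have b2 : enorm (W' z) <= (1 + n%:R) * r.
  have h := le_trans (residual_nonexpansive resW' z y) zy.
  apply: (le_trans (enorm_le_add _ (W' y))); have := Wr'; lra.
have := ler_wpM2l d0 b1; have := ler_wpM2l d0 b2 => h3 h4.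
by rewrite ler_norml; lra.
Qed.

(* [W - W'] is the gradient of the difference of the energies, so its sum along
   a line telescopes: this gains one order over the 1/2-Hoelder dependence of a
   projection on the body. *)
Lemma residual_line_sum k (b : 'rV[R]_n) i : 0 < r ->
  (forall j, (j <= k.+1)%N ->
     enorm (b + (j%:R / k.+1%:R) *: delta_mx 0 i) <= n%:R) ->
  `|\sum_(0 <= j < k.+1)
      (W (y + r *: (b + (j%:R / k.+1%:R) *: delta_mx 0 i)) -
       W' (y + r *: (b + (j%:R / k.+1%:R) *: delta_mx 0 i))) 0 i| <=
  k.+1%:R * (2 * (1 + n%:R) * d + r / k.+1%:R).
Proof.
move=> r0 hb.
pose h : R := r / k.+1%:R; have h0 : 0 < h by rewrite divr_gt0.
have hk : h * k.+1%:R = r by rewrite divfK// pnatr_eq0.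
pose z j := y + r *: (b + (j%:R / k.+1%:R) *: delta_mx 0 i).
rewrite -/(z _); pose D j := energy W (z j) - energy W' (z j).
have zS j : z j.+1 - z j = h *: delta_mx 0 i.
  rewrite /z opprD addrACA subrr add0r -scalerBr opprD addrACA subrr add0r.
  rewrite -scalerBl -mulrBl scalerA mulrA.
  by rewrite -natr1 addrAC subrr add0r mulr1.
(* Both second-order remainders lie between 0 and [h ^+ 2], hence so does the modulus of their
   difference. *)
have step j : `|D j.+1 - D j - h * (W (z j) - W' (z j)) 0 i| <= h ^+ 2.
  have := energy_expand resW (z j) (z j.+1).
  have := energy_expand resW' (z j) (z j.+1).
  rewrite zS enormZ enorm_delta mulr1 gtr0_norm// !dotZr !dot_delta !mxE /D.
  by move=> /andP[h1 h2] /andP[h3 h4]; rewrite ler_norml; lra.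
have Dbd j : (j <= k.+1)%N -> `|D j| <= d * ((1 + n%:R) * r).
  move=> jk; apply: energy_close; rewrite /z addrAC subrr add0r enormZ.
  by rewrite gtr0_norm// mulrC ler_wpM2r ?hb// ltW.
set s := \sum_(0 <= j < k.+1) _.
have hs : `|D k.+1 - D 0%N - h * s| <= k.+1%:R * h ^+ 2.
  rewrite -(telescope_sumr D (leq0n k.+1)) mulr_sumr -sumrB.
  apply: (le_trans (ler_norm_sum _ _ _)); rewrite big_mkord.
  apply: (@le_trans _ _ (\sum_(j < k.+1) h ^+ 2)); last first.
    by rewrite sumr_const card_ord mulr_natl.
  by apply: ler_sum => j _; exact: step.
have := Dbd 0%N isT; have := Dbd k.+1 (leqnn _).
move: hs; rewrite -/h; move: (D k.+1) (D 0%N) => D1 D2.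
rewrite !ler_norml => /andP[h1 h2] /andP[h3 h4] /andP[h5 h6].
by apply/andP; split; rewrite -(ler_pM2l h0); nra.
Qed.

Lemma residual_grid_mean k i :
  `|grid_mean k (fun u => (W (y + r *: u) - W' (y + r *: u)) 0 i)| <=
  2 * (1 + n%:R) * d + r / k.+1%:R.
Proof.
have r_ge0 : 0 <= r by apply: le_trans Wr; exact: enorm_ge0.
(* If [r = 0], then [y] lies in both bodies and every sample point is [y]. *)
have [r0|r0] := eqVneq r 0.
  have Wy0 : W y = 0.
    by apply: enorm0_eq0; apply/eqP; rewrite eq_le enorm_ge0 -{1}r0 Wr.
  have Wy0' : W' y = 0.
    by apply: enorm0_eq0; apply/eqP; rewrite eq_le enorm_ge0 -{1}r0 Wr'.
  rewrite r0 mul0r addr0; apply: normr_grid_mean_le => u _.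
  by rewrite scale0r addr0 Wy0 Wy0' subrr mxE normr0 !mulr_ge0// addr_ge0.
have {}r0 : 0 < r by rewrite lt0r r0.
apply: (@normr_grid_mean_lines _ _ _ _ i) => phi.
pose b := grid_point (update phi i 0) : 'rV[R]_n.
have ptE j : grid_point (update phi i j) = b + (j%:R / k.+1%:R) *: delta_mx 0 i.
  apply/rowP => i'; rewrite !mxE !ffunE eqxx/=.
  by case: eqP => [_|_]; rewrite ?mul0r ?add0r ?mulr1 ?mulr0 ?addr0.
under eq_bigr do rewrite ptE.
(* The end [j = k.+1] of the telescoped line is not a grid point but still lies in the unit cube. *)
have := @residual_line_sum k b i r0; rewrite big_mkord; apply => j jk.
apply: enorm_unit_box => i'; rewrite !mxE !ffunE eqxx/=.
case: eqP => [_|_]; rewrite ?mul0r ?add0r ?mulr1 ?mulr0 ?addr0.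
  by rewrite divr_ge0//= ler_pdivrMr// mul1r ler_nat.
by rewrite divr_ge0//= ler_pdivrMr// mul1r ler_nat ltnW.
Qed.

End TwoBodies.

Definition smoothed_projection k W (r : R) y : 'rV[R]_n :=
  \row_i grid_mean k (fun u => ((y + r *: u) - W (y + r *: u)) 0 i).

(** A mean of points of a convex body stays in the body. *)
Lemma smoothed_projection_in k S W r y w : residual S W ->
  dot (smoothed_projection k W r y) w <= S w.
Proof.
move=> resW; rewrite (dot_grid_mean k (fun u => (y + r *: u) - W (y + r *: u))).
by apply: grid_mean_le => u _; have [] := resW (y + r *: u).
Qed.

(** Three moves: enlarge the radius from [r] to a common [q], exchange the bodies at fixed [y] and
    [q], then pass from [(q, y)] to [(r', y')]. Their costs in [d] are [2 * n], [2 * (1 + n)] and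
    [2 * n]. *)
Lemma smoothed_projection_compare k S S' W W' r r' y y' d i :
  residual S W -> residual S' W' -> 0 <= d ->
  (forall w, `|S w - S' w| <= d * enorm w) ->
  r = enorm (W y) -> r' = enorm (W' y') ->
  `|smoothed_projection k W r y 0 i - smoothed_projection k W' r' y' 0 i| <=
   (6 * n%:R + 2) * d + (1 + n%:R) * enorm (y - y') +
   (r + enorm (W' y)) / k.+1%:R.
Proof.
move=> resW resW' d0 SS' rE rE'.
(* For a fixed body, projections are nonexpansive and each sample point moves by at most the right
   side. *)
have lip (V : 'rV[R]_n -> 'rV[R]_n) T a b (z z' : 'rV[R]_n) : residual T V ->
  `|smoothed_projection k V a z 0 i - smoothed_projection k V b z' 0 i| <=
  enorm (z - z') + n%:R * `|a - b|.
  move=> resV; rewrite !mxE grid_meanB; apply: normr_grid_mean_le => u un.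
  have := projection_nonexpansive resV (z + a *: u) (z' + b *: u).
  have := coord_le_enorm ((z + a *: u - V (z + a *: u)) -
     (z' + b *: u - V (z' + b *: u))) i; rewrite !mxE => h1 h2.
  apply: (le_trans h1); apply: (le_trans h2).
  have -> : z + a *: u - (z' + b *: u) = (z - z') + (a - b) *: u.
    by rewrite scalerBl opprD addrACA.
  apply: (le_trans (enormD _ _)); rewrite lerD2l enormZ mulrC.
  by rewrite ler_wpM2r.
have [r1 r1E] : exists r1, r1 = enorm (W' y) by exists (enorm (W' y)).
have r0 : 0 <= r by rewrite rE enorm_ge0.
have r10 : 0 <= r1 by rewrite r1E enorm_ge0.
have S'S w : `|S' w - S w| <= d * enorm w by rewrite distrC.
have c1 := residual_norm_compare resW resW' SS' y d0.
have c2 := residual_norm_compare resW' resW S'S y d0.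
rewrite -rE -r1E in c1 c2.
(* The larger of the two distances at [y] dominates both residuals, as the exchange of bodies
   requires. *)
have [q [hr h1 q_le aq aq1]] : exists q, [/\ r <= q, r1 <= q, q <= r + r1,
    `|r - q| <= 2 * d & `|q - r1| <= 2 * d].
  exists (Num.max r r1); rewrite !ler_norml.
  by case: (leP r r1) => h; split; rewrite ?lexx//; lra.
have ar : `|r1 - r'| <= enorm (y - y').
  rewrite rE' r1E (le_trans (ler_dist_enorm _ _))//.
  exact: residual_nonexpansive resW' _ _.
have s1 := lip W S r q y y resW.
have s3 := lip W' S' q r' y y' resW'.
have hW : enorm (W y) <= q by rewrite -rE.
have hW' : enorm (W' y) <= q by rewrite -r1E.
have s2 := residual_grid_mean resW resW' d0 SS' hW hW' k i.
have s2' : `|smoothed_projection k W q y 0 i - smoothed_projection k W' q y 0 i|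
    <= 2 * (1 + n%:R) * d + q / k.+1%:R.
  apply: le_trans s2; rewrite !mxE grid_meanB -normrN /grid_mean -mulrN -sumrN.
  rewrite le_eqVlt; apply/orP; left; apply/eqP; congr (`| _ * _|).
  by apply: eq_bigr => phi _; rewrite !mxE; ring.
have kq : q / k.+1%:R <= (r + r1) / k.+1%:R by rewrite ler_pM2r ?invr_gt0.
have qr' : `|q - r'| <= 2 * d + enorm (y - y').
  by rewrite (le_trans (ler_distD r1 _ _))// lerD.
have t1 : n%:R * `|r - q| <= n%:R * (2 * d) by rewrite ler_wpM2l.
have t2 : n%:R * `|q - r'| <= n%:R * (2 * d + enorm (y - y')) by rewrite ler_wpM2l.
move: s1; rewrite subrr enorm0 => s1.
apply: (le_trans (ler_distD (smoothed_projection k W q y 0 i) _ _)).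
apply: (le_trans (lerD (le_trans s1 (lerD (lexx 0) t1)) (le_trans
  (ler_distD (smoothed_projection k W' q y 0 i) _ _)
  (lerD (le_trans s2' (lerD (lexx _) kq)) (le_trans s3 (lerD (lexx _) t2)))))).
by rewrite -r1E le_eqVlt; apply/orP; left; apply/eqP; ring.
Qed.

End Selection.

(** * Ultralimits and the Lipschitz selection from convex bodies *)

Section Ultralimit.
Context {R : realType}.

(** An ultrafilter pushed forward to a compact segment converges. One [U] serves all bounded
    sequences, so limits can be compared, and it refines [\oo], so ordinary limits are kept.
    Unbounded sequences get the dummy limit 0. *)
Lemma ultralimit_exists : exists (U : set_system nat) (L : (nat -> R) -> R),
  [/\ ProperFilter U, \oo `<=` U &
      forall u M, (forall k, `|u k| <= M) -> u @ U --> L u].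
Proof.
have [U [UU ooU]] := @ultraFilterLemma nat \oo _.
have PU : ProperFilter U by exact: ultra_proper.
have /choice[L hL] : forall u : nat -> R, exists l : R,
    forall M, (forall k, `|u k| <= M) -> u @ U --> l.
  move=> u; have [[M uM]|nM] := pselect (exists M, forall k, `|u k| <= M);
    last by exists 0 => M uM; case: nM; exists M.
  have uUU : UltraFilter (u @ U).
    split; first exact: fmap_proper_filter.
    move=> G PG uG; rewrite predeqE => A; split=> [GA|/uG//].
    have [//|FnA] := in_ultra_setVsetC (u @^-1` A) UU.
    have := @filter_not_empty _ G _; case; rewrite -(setICr A).
    by apply: filterI => //; apply: uG.
  have := @segment_compact R (- M) M; rewrite compact_ultra => /(_ _ uUU)[].
    apply: (@filterS _ U _ setT); last exact: filterT.
    by move=> k _ /=; rewrite in_itv/= -ler_norml.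
  by move=> l [_ ul]; exists l.
by exists U, L; split => // u M uM; exact: hL uM.
Qed.

End Ultralimit.

(** [sel S y] is the ultralimit of the smoothed projections whose radius is the distance from [y] to
    the body; the error in [1 / k.+1] disappears in the limit. *)
Lemma convex_body_selection (R : realType) (n : nat) :
  exists (sel : ('rV[R]_n -> R) -> 'rV[R]_n -> 'rV[R]_n) (C : R),
  0 <= C /\ forall S M, sublinear_bounded S M ->
  [/\ forall y w, dot (sel S y) w <= S w,
      forall y, (forall w, dot y w <= S w) -> sel S y = y &
      forall S' M' d y y', sublinear_bounded S' M' -> 0 <= d ->
        (forall w, `|S w - S' w| <= d * enorm w) ->
        enorm (sel S y - sel S' y') <= C * (d + enorm (y - y'))].
Proof.
have [U [L [PU ooU hL]]] := @ultralimit_exists R.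
have /choice[res hres] : forall S : 'rV[R]_n -> R, exists W,
    forall M, sublinear_bounded S M -> residual S W.
  (* [id] is a dummy value when [S] is not a support function. *)
  move=> S; have [[M SM]|nM] := pselect (exists M, sublinear_bounded S M);
    last by exists id => M SM; case: nM; exists M.
  by have [W hW] := residual_exists SM; exists W.
pose p k S y := smoothed_projection k (res S) (enorm (res S y)) y.
pose sel S y : 'rV[R]_n := \row_i L (fun k => p k S y 0 i).
have cvgp S M y i : sublinear_bounded S M ->
    p k S y 0 i @[k --> U] --> sel S y 0 i.
  move=> SM; rewrite mxE.
  (* Testing membership in the body against the point [p k S y] itself bounds its norm by [|M|]. *)
  apply: (hL _ `|M|) => k; apply: (le_trans (coord_le_enorm _ _)).
  have h1 := smoothed_projection_in k (enorm (res S y)) y (p k S y) (hres S M SM).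
  have [_ _ /(_ (p k S y)) h2] := SM.
  have := le_trans h1 (le_trans (ler_norm _) h2); rewrite -/(p k S y) enorm_sqr.
  have [->//|a0] := eqVneq (enorm (p k S y)) 0.
  rewrite expr2 ler_pM2r; last by rewrite lt0r a0 enorm_ge0.
  by move=> /le_trans; apply; exact: ler_norm.
(* The factor [n] passes from coordinates to the norm; [6 * n + 2] also dominates [1 + n]. *)
exists sel, (n%:R * (6 * n%:R + 2)); split.
  by rewrite mulr_ge0// addr_ge0// mulr_ge0.
move=> S M SM; have resS := hres S M SM; split.
- move=> y w.
  have cd : dot (p k S y) w @[k --> U] --> dot (sel S y) w.
    by apply: cvg_dot => i; [exact: cvgp SM|exact: cvg_cst].
  apply: (@ler_cvg_to _ U _ R _ _ _ _ cd (@cvg_cst _ (S w) _ U _)).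
  by apply: nearW => k; exact: smoothed_projection_in.
(* For [y] in the body the radius is 0, so only [y] is sampled. *)
- move=> y yS; have W0 := residual_eq0 resS yS.
  have py k i : p k S y 0 i = y 0 i.
    apply/eqP; rewrite eq_le mxE W0 enorm0 grid_mean_le ?grid_mean_ge// => u _;
      by rewrite scale0r addr0 W0 subr0.
  apply/rowP => i; have := cvgp S M y i SM; under eq_fun do rewrite py.
  by move=> /(cvg_unique (@Rhausdorff R) (cvg_cst (y 0 i)))<-.
move=> S' M' d y y' SM' d0 SS'.
have resS' := hres S' M' SM'.
rewrite -mulrA; apply: enorm_le_coord => i.
pose c := enorm (res S y) + enorm (res S' y).
have cd : `|p k S y 0 i - p k S' y' 0 i| @[k --> U] -->
    `|(sel S y - sel S' y') 0 i|.
  rewrite !mxE; apply: cvg_norm; apply: cvgB.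
    by have := cvgp S M y i SM; rewrite mxE.
  by have := cvgp S' M' y' i SM'; rewrite mxE.
have cr : (6 * n%:R + 2) * d + (1 + n%:R) * enorm (y - y') + c / k.+1%:R
   @[k --> U] --> (6 * n%:R + 2) * d + (1 + n%:R) * enorm (y - y') + c * 0.
  apply: cvgD; first exact: cvg_cst.
  apply: cvgM; first exact: cvg_cst.
  by apply: (cvg_trans _ (@cvg_harmonic R)); apply: cvg_app.
have := @ler_cvg_to _ U _ R _ _ _ _ cd cr; rewrite mulr0 addr0 => h.
apply: (@le_trans _ _ ((6 * n%:R + 2) * d + (1 + n%:R) * enorm (y - y'))).
  apply: h; apply: nearW => k.
  exact: smoothed_projection_compare resS resS' d0 SS' _ _.
have := enorm_ge0 (y - y'); have : 0 <= n%:R :> R by []; nra.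
Qed.

(** * Splitting of [R^(N+1)] into a height and a point of [R^N] *)

Section HeadTail.
Context {R : realType} {N : nat}.
Implicit Types (a : R) (v p : 'rV[R]_N) (u w k : 'rV[R]_N.+1).

Definition hd w : R := w 0 ord0.
Definition tl w : 'rV[R]_N := \row_j w 0 (lift ord0 j).
Definition pack a v : 'rV[R]_N.+1 :=
  \row_i (if unlift ord0 i is Some j then v 0 j else a).

Lemma hd_pack a v : hd (pack a v) = a.
Proof. by rewrite /hd mxE unlift_none. Qed.

Lemma tl_pack a v : tl (pack a v) = v.
Proof. by apply/rowP => j; rewrite !mxE liftK. Qed.

Lemma packK w : pack (hd w) (tl w) = w.
Proof.
by apply/rowP => i; rewrite mxE; case: unliftP => [j|] ->; rewrite ?mxE.
Qed.

Lemma tlB u w : tl (u - w) = tl u - tl w.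
Proof. by apply/rowP => j; rewrite !mxE. Qed.

Lemma hdB u w : hd (u - w) = hd u - hd w.
Proof. by rewrite /hd !mxE. Qed.

Lemma dotS u w : dot u w = hd u * hd w + dot (tl u) (tl w).
Proof.
by rewrite /dot big_ord_recl; congr (_ + _); apply: eq_bigr => j _; rewrite !mxE.
Qed.

Lemma enormS w : enorm w ^+ 2 = hd w ^+ 2 + enorm (tl w) ^+ 2.
Proof. by rewrite -!enorm_sqr dotS expr2. Qed.

Lemma hd_le w : `|hd w| <= enorm w.
Proof. exact: coord_le_enorm. Qed.

Lemma tl_le w : enorm (tl w) <= enorm w.
Proof.
rewrite -(@ler_pXn2r _ 2)// ?nnegrE ?enorm_ge0// enormS lerDr.
exact: sqr_ge0.
Qed.

Lemma enorm_hd_tl w : enorm w <= `|hd w| + enorm (tl w).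
Proof.
rewrite -(@ler_pXn2r _ 2)// ?nnegrE ?enorm_ge0 ?addr_ge0 ?enorm_ge0//.
rewrite enormS -(real_normK (num_real (hd w))).
have := normr_ge0 (hd w); have := enorm_ge0 (tl w).
move: (enorm _) (`|_|) => b a b0 a0; nra.
Qed.

End HeadTail.

(** * Approximate affine minorants of convex functions *)

Section Fenchel.
Context {R : realType} {N : nat}.
Variables (h : 'rV[R]_N -> R) (L : R).

(* The proximal point of [mu h] at [q] carries a subgradient; as [mu] tends to 0
   it tends to [q]. *)
Lemma affine_minorant_approx (q : 'rV[R]_N) (e : R) :
  (forall p q s, 0 <= s <= 1 ->
     h ((1 - s) *: p + s *: q) <= (1 - s) * h p + s * h q) ->
  (forall p q, `|h p - h q| <= L * enorm (p - q)) -> 0 < e ->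
  exists v b, (forall p, dot v p - h p <= b) /\ h q - e <= dot q v - b.
Proof.
move=> cvx lip e0.
pose L1 := `|L| + 1.
have L10 : 0 < L1 by rewrite ltr_wpDl.
(* With [d] the distance from [q] to the proximal point, the error [L1 * d - d ^+ 2 / mu] is at most
   [mu * L1 ^+ 2 = e]. *)
pose mu := e / L1 ^+ 2; have mu0 : 0 < mu by rewrite divr_gt0// exprn_gt0.
have muL : mu * L1 ^+ 2 = e by rewrite divfK// gt_eqF// exprn_gt0.
have [||p hp] := @prox_exists R N (fun p => mu * h p) (mu * L) q.
- by move=> p p' s hs; have := ler_wpM2l (ltW mu0) (cvx p p' s hs); lra.
- move=> p p'; rewrite -mulrBr normrM gtr0_norm// -mulrA.
  by rewrite ler_wpM2l ?lip// ltW.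
exists (mu^-1 *: (q - p)), (dot (mu^-1 *: (q - p)) p - h p); split.
  move=> p'; have := hp p'; rewrite dotDr dotNr => hp'.
  rewrite -(ler_pM2l mu0) !mulrBr !dotZl !mulrA mulfV ?gt_eqF// !mul1r; lra.
have qp : dot q (mu^-1 *: (q - p)) - (dot (mu^-1 *: (q - p)) p - h p) =
    mu^-1 * enorm (q - p) ^+ 2 + h p.
  by rewrite -enorm_sqr !(dotZl, dotZr) (dotC q) !(dotDl, dotDr, dotNl, dotNr); ring.
rewrite qp.
have d0 := enorm_ge0 (q - p).
have lpq : h q - h p <= L1 * enorm (q - p).
  apply: (le_trans (ler_norm _)); apply: (le_trans (lip _ _)).
  by rewrite ler_wpM2r// /L1 (le_trans (ler_norm L))// lerDl.
rewrite -lerBlDr ler_pdivlMl//.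
have hsq := sqr_ge0 (enorm (q - p) - mu * L1).
have hmu : (mu * L1) ^+ 2 = mu * e by rewrite -muL; ring.
have hl := ler_wpM2l (ltW mu0) lpq.
have he := mulr_gt0 mu0 e0.
move: hsq hl; rewrite sqrrB hmu; nra.
Qed.

End Fenchel.

(** * Support functions of truncated epigraphs *)

Section TruncatedEpigraph.
Context {R : realType} {N : nat}.
Implicit Types (h : 'rV[R]_N -> R) (l : R).

(* The height of the truncated epigraph of the conjugate of [h] is the first
   coordinate. *)
Definition body h l : set 'rV[R]_N.+1 :=
  [set k | (forall p, dot (tl k) p - h p <= hd k) /\ hd k <= l].

(** The last clause is an approximate Fenchel-Moreau duality: [h] is the supremum of its affine
    minorants coming from the truncated epigraph. *)
Definition admissible h l :=
  [/\ 0 <= l,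
      forall k, body h l k -> enorm (tl k) <= l /\ `|hd k| <= l &
      forall q e, 0 < e -> exists2 k, body h l k &
        h q - e <= dot q (tl k) - hd k].

Definition suppf h l (w : 'rV[R]_N.+1) : R := sup [set dot w k | k in body h l].

Section Admissible.
Variables (h : 'rV[R]_N -> R) (l : R).
Hypothesis adm : admissible h l.

Lemma body_nonempty : exists k, body h l k.
Proof. by have [_ _ /(_ 0 1 ltr01)[k hk _]] := adm; exists k. Qed.

Lemma enorm_body k : body h l k -> enorm k <= 2 * l.
Proof.
have [_ bnd _] := adm; move=> /bnd[h1 h2].
apply: (le_trans (enorm_hd_tl k)); lra.
Qed.

Lemma dot_le_support k w : body h l k -> dot w k <= suppf h l w.
Proof.
move=> bk; apply: sup_ubound; last by exists k.
exists (enorm w * (2 * l)) => _ [k' bk' <-].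
by rewrite (le_trans (dot_le _ _))// ler_wpM2l ?enorm_ge0 ?enorm_body.
Qed.

Lemma support_le w c : (forall k, body h l k -> dot w k <= c) ->
  suppf h l w <= c.
Proof.
move=> hc; apply: ge_sup => [|_ [k /hc + <-]//].
by have [k bk] := body_nonempty; exists (dot w k); exists k.
Qed.

Lemma support_sublinear : sublinear_bounded (suppf h l) (2 * l).
Proof.
have [l0 _ _] := adm; split.
- move=> u v; apply: support_le => k bk.
  by rewrite dotDl lerD// dot_le_support.
- have hle (c : R) (u : 'rV[R]_N.+1) : 0 <= c ->
      suppf h l (c *: u) <= c * suppf h l u.
    move=> c0; apply: support_le => k bk.
    by rewrite dotZl ler_wpM2l// dot_le_support.
  move=> c u; rewrite le_eqVlt => /predU1P[<-|c0].
    rewrite scale0r mul0r; apply/eqP; rewrite eq_le; apply/andP; split.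
      by apply: support_le => k _; rewrite dot0l.
    by have [k bk] := body_nonempty; rewrite -(dot0l k) dot_le_support.
  have ci : 0 < c^-1 by rewrite invr_gt0.
  apply/eqP; rewrite eq_le hle ?(ltW c0)//= -(ler_pM2l ci).
  rewrite mulrA mulVf ?gt_eqF// mul1r.
  have := hle c^-1 (c *: u); rewrite scalerA mulVf ?gt_eqF// scale1r.
  by apply; rewrite invr_ge0 ltW.
- move=> u; rewrite ler_norml; apply/andP; split.
    have [k bk] := body_nonempty; apply: le_trans (dot_le_support u bk).
    rewrite lerNl -dotNl (le_trans (dot_le _ _))// enormN mulrC.
    by rewrite ler_wpM2r ?enorm_ge0 ?enorm_body.
  apply: support_le => k bk; rewrite (le_trans (dot_le _ _))// mulrC.
  by rewrite ler_wpM2r ?enorm_ge0 ?enorm_body.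
Qed.

Lemma support_lipschitz u w : suppf h l u - suppf h l w <= 2 * l * enorm (u - w).
Proof.
have [sub _ bnd] := support_sublinear.
have := sub (u - w) w; rewrite subrK => h1.
have := le_trans (ler_norm _) (bnd (u - w)); lra.
Qed.

(** Downward directions see only the lower boundary of the epigraph, so the truncation leaves no
    trace and duality at [s^-1 *: p] yields the perspective of [h]. *)
Lemma support_perspective s p : 0 < s ->
  suppf h l (pack (- s) p) = s * h (s^-1 *: p).
Proof.
move=> s0; have sE : s * s^-1 = 1 by rewrite mulfV ?gt_eqF.
apply/eqP; rewrite eq_le; apply/andP; split.
  apply: support_le => k [hk _]; rewrite dotS hd_pack tl_pack.
  have := ler_wpM2l (ltW s0) (hk (s^-1 *: p)).
  rewrite mulrBr dotZr mulrA sE mul1r (dotC p); lra.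
apply/ler_addgt0Pr => e e0.
have [_ _ /(_ (s^-1 *: p) (e / s) (divr_gt0 e0 s0))[k bk hk]] := adm.
have := dot_le_support (pack (- s) p) bk; rewrite dotS hd_pack tl_pack.
have := ler_wpM2l (ltW s0) hk.
by rewrite mulrBr (mulrC e) mulrA sE mul1r mulrBr dotZl mulrA sE mul1r; lra.
Qed.

(** Every point of the body can be raised to height [l] inside the body, so upward directions are
    maximised on the top face. *)
Lemma support_up tau p : 0 <= tau ->
  suppf h l (pack tau p) = suppf h l (pack 0 p) + tau * l.
Proof.
move=> tau0; apply/eqP; rewrite eq_le; apply/andP; split.
  apply: support_le => k bk; have [_ kl] := bk.
  have := dot_le_support (pack 0 p) bk; rewrite !dotS !hd_pack !tl_pack mul0r.
  have := ler_wpM2l tau0 kl; lra.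
rewrite -lerBrDr; apply: support_le => k [hk kl].
have bl : body h l (pack l (tl k)).
  split; rewrite hd_pack ?tl_pack// => q; exact: le_trans (hk q) kl.
have := dot_le_support (pack tau p) bl; rewrite !dotS !hd_pack !tl_pack; lra.
Qed.

End Admissible.

Section Compare.
Variables (h h' : 'rV[R]_N -> R) (l l' : R).
Hypotheses (adm : admissible h l) (adm' : admissible h' l').

Lemma support_compare_down s p : 0 < s ->
  `|suppf h l (pack (- s) p) - suppf h' l' (pack (- s) p)| =
  s * `|h (s^-1 *: p) - h' (s^-1 *: p)|.
Proof.
by move=> s0; rewrite !support_perspective// -mulrBr normrM gtr0_norm.
Qed.

(** The horizontal direction is at distance [s] from [pack (- s) p], where the perspective formula
    applies; the Lipschitz constants [2 * l] and [2 * l'] give the error in [s], which is free. *)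
Lemma support_compare_up tau p s : 0 <= tau -> 0 < s ->
  `|suppf h l (pack tau p) - suppf h' l' (pack tau p)| <=
  s * `|h (s^-1 *: p) - h' (s^-1 *: p)| + 2 * (l + l') * s + tau * `|l - l'|.
Proof.
move=> tau0 s0; rewrite (support_up adm)// (support_up adm')//.
have -> : suppf h l (pack 0 p) + tau * l - (suppf h' l' (pack 0 p) + tau * l') =
  suppf h l (pack 0 p) - suppf h' l' (pack 0 p) + tau * (l - l') by ring.
apply: (le_trans (ler_normD _ _)).
rewrite normrM (ger0_norm tau0) lerD2r -support_compare_down//.
have e1 : enorm (pack 0 p - pack (- s) p) = s.
  apply/eqP; rewrite -(@eqrXn2 _ 2)// ?enorm_ge0 ?(ltW s0)// enormS hdB tlB.
  by rewrite !hd_pack !tl_pack subrr enorm0 expr0n addr0 opprK add0r.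
have a1 := support_lipschitz adm (pack 0 p) (pack (- s) p).
have a2 := support_lipschitz adm (pack (- s) p) (pack 0 p).
have b1 := support_lipschitz adm' (pack 0 p) (pack (- s) p).
have b2 := support_lipschitz adm' (pack (- s) p) (pack 0 p).
move: a1 a2 b1 b2; rewrite (enormB (pack (- s) p)) e1.
move: (suppf h l (pack 0 p)) (suppf h l (pack (- s) p))
  (suppf h' l' (pack 0 p)) (suppf h' l' (pack (- s) p)) => A B A' B' *.
have : - `|B - B'| <= B - B' <= `|B - B'| by rewrite -ler_norml.
move: (`|B - B'|) => c /andP[*]; rewrite ler_norml; lra.
Qed.

(** The linear growth in [p] makes [s * |h (p / s) - h' (p / s)|] at most [kappa * (s + enorm p)],
    bounded as [s] tends to 0. Downward directions take [s = - tau]; the others let [s] vanish. *)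
Lemma support_compare kappa zeta : 0 <= kappa -> 0 <= zeta ->
  (forall p, `|h p - h' p| <= kappa * (1 + enorm p)) -> `|l - l'| <= zeta ->
  forall w, `|suppf h l w - suppf h' l' w| <= (2 * kappa + zeta) * enorm w.
Proof.
move=> k0 z0 hh ll w; rewrite -(packK w); set tau := hd w; set p := tl w.
have hs s : 0 < s -> s * `|h (s^-1 *: p) - h' (s^-1 *: p)| <= kappa * (s + enorm p).
  move=> s0; have := ler_wpM2l (ltW s0) (hh (s^-1 *: p)).
  have si : 0 < s^-1 by rewrite invr_gt0.
  rewrite enormZ (gtr0_norm si) mulrCA mulrDr mulrA mulfV ?gt_eqF//.
  by rewrite mulr1 mul1r.
have pw : enorm p <= enorm (pack tau p) by rewrite packK tl_le.
have tw : `|tau| <= enorm (pack tau p) by rewrite packK hd_le.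
have w0 := enorm_ge0 (pack tau p).
have [tau0|tau0] := leP 0 tau.
  have main : `|suppf h l (pack tau p) - suppf h' l' (pack tau p)| -
      (kappa * enorm p + tau * zeta) <= 0.
    apply: (@le0_of_small _ _ (kappa + 2 * (l + l'))) => s /andP[s0 s1].
    have := support_compare_up p tau0 s0; have := hs s s0.
    have := ler_wpM2l tau0 ll.
    move: (`|_ - _|) (`|_ - _|) (`|_ - _|) => A B C *; lra.
  move: tw; rewrite ger0_norm// => tw.
  rewrite -[leLHS](subrK (kappa * enorm p + tau * zeta)).
  rewrite (le_trans (lerD main (lexx _)))// add0r.
  have := ler_wpM2l k0 pw; have := ler_wpM2r z0 tw.
  have := mulr_ge0 k0 w0; lra.
have {}tau0 : 0 < - tau by rewrite oppr_gt0.
have := support_compare_down p tau0; rewrite opprK => ->.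
apply: (le_trans (hs _ tau0)).
move: tw; rewrite ltr0_norm -?oppr_gt0// => tw.
have := ler_wpM2l k0 pw; have := ler_wpM2l k0 tw; have := mulr_ge0 z0 w0; lra.
Qed.

End Compare.
End TruncatedEpigraph.

(** * Convergence of support functions *)

Section SupportConvergence.
Context {R : realType} {N : nat} {I : Type} (F : set_system I) {FF : Filter F}.
Variables (h : I -> 'rV[R]_N -> R) (l : I -> R) (h0 : 'rV[R]_N -> R) (l0 : R).

Lemma support_cvg_pointwise (w : 'rV[R]_N.+1) (d : R) : admissible h0 l0 ->
  (\forall i \near F, admissible (h i) (l i)) ->
  (forall p, h i p @[i --> F] --> h0 p) -> l i @[i --> F] --> l0 -> 0 < d ->
  \forall i \near F, `|suppf (h i) (l i) w - suppf h0 l0 w| < d.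
Proof.
move=> adm0 admF hF lF d0; rewrite -(packK w).
have [l00 _ _] := adm0.
have nh p (e : R) : 0 < e -> \forall i \near F, `|h i p - h0 p| < e.
  move=> e0; have /cvgrPdist_lt/(_ e e0) := hF p.
  by apply: filterS => i; rewrite distrC.
have nl (e : R) : 0 < e -> \forall i \near F, `|l i - l0| < e.
  move=> e0; have /cvgrPdist_lt/(_ e e0) := lF.
  by apply: filterS => i; rewrite distrC.
have [tau0|tau0] := leP 0 (hd w); last first.
  have {}tau0 : 0 < - hd w by rewrite oppr_gt0.
  have e0 : 0 < d / (- hd w) by rewrite divr_gt0.
  apply: filterS2 admF (nh ((- hd w)^-1 *: tl w) _ e0) => i admi hi.
  have := support_compare_down admi adm0 (tl w) tau0; rewrite opprK => ->.
  by rewrite mulrC -ltr_pdivlMr.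
(* [m] bounds [2 * (l i + l0)] once [l i < l0 + 1]. Since [s] is fixed before [i], convergence of
   [h i] at the single point [s^-1 *: tl w] is enough. *)
pose m := 2 * (l0 + l0 + 1); have m0 : 0 < m by rewrite /m; lra.
pose s := d / (3 * m); have s0 : 0 < s by rewrite divr_gt0// mulr_gt0.
have sm : s * m = d / 3 by rewrite /s; field; rewrite gt_eqF.
have d3 : 0 < d / 3 by rewrite divr_gt0.
have e1 : 0 < d / 3 / s by exact: divr_gt0.
have e2 : 0 < d / 3 / (hd w + 1) by rewrite divr_gt0// ltr_wpDl.
apply: filterS3 (filterI admF (nl 1 ltr01)) (nh (s^-1 *: tl w) _ e1) (nl _ e2).
move=> i [admi li1] hi li.
apply: le_lt_trans (support_compare_up admi adm0 (tl w) tau0 s0) _.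
have b1 : s * `|h i (s^-1 *: tl w) - h0 (s^-1 *: tl w)| < d / 3.
  by rewrite mulrC -ltr_pdivlMr.
have b2 : 2 * (l i + l0) * s <= d / 3.
  rewrite -sm mulrC ler_wpM2l ?(ltW s0)// /m.
  by have := le_lt_trans (ler_norm _) li1; lra.
have b3 : hd w * `|l i - l0| < d / 3.
  apply: (@le_lt_trans _ _ ((hd w + 1) * `|l i - l0|)).
    by rewrite ler_wpM2r// lerDl.
  by rewrite mulrC -ltr_pdivlMr ?ltr_wpDl.
move: b1 b2 b3; move: (`|_ - _|) (`|_ - _|) => A B; lra.
Qed.

(** The support functions are eventually equi-Lipschitz, so pointwise convergence is uniform on the
    compact cube; homogeneity extends it to all [w]. *)
Lemma support_cvg_uniform (d : R) : admissible h0 l0 ->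
  (\forall i \near F, admissible (h i) (l i)) ->
  (forall p, h i p @[i --> F] --> h0 p) -> l i @[i --> F] --> l0 -> 0 < d ->
  \forall i \near F, forall w,
    `|suppf (h i) (l i) w - suppf h0 l0 w| <= d * enorm w.
Proof.
move=> adm0 admF hF lF d0.
have [l00 _ _] := adm0.
pose J (i : 'I_N.+1) := `[(-1 : R), 1]%classic.
pose A := [set w : 'rV[R]_N.+1 | forall i, J i (w 0 i)].
have cA : compact A by apply: (@rV_compact _ _ J) => i; exact: segment_compact.
have [_ homS0 _] := support_sublinear adm0.
pose P i w := `|suppf (h i) (l i) w - suppf h0 l0 w| <= d.
suff : \forall i \near F, A `<=` P i.
  apply: filterS2 admF => i admi AP w.
  have [_ homSi _] := support_sublinear admi.
  have [->|w0] := eqVneq w 0.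
    rewrite enorm0 mulr0 -(scale0r (0 : 'rV[R]_N.+1)).
    by rewrite homSi// homS0// !mul0r subrr normr0.
  have wn : 0 < enorm w.
    rewrite lt0r enorm_ge0 andbT; apply: contra w0 => /eqP/enorm0_eq0/eqP//.
  have wi : 0 <= (enorm w)^-1 by rewrite invr_ge0 ltW.
  have : P i ((enorm w)^-1 *: w).
    apply: AP => j; rewrite /J/= in_itv/= -ler_norml mxE normrM ger0_norm//.
    by rewrite mulrC ler_pdivrMr// mul1r coord_le_enorm.
  rewrite /P homSi// homS0// -mulrBr normrM ger0_norm//.
  by rewrite mulrC ler_pdivrMr.
have [+ _] := compact_near_coveringP A => /(_ cA _ F P FF); apply => w Aw.
pose m := 2 * (l0 + 1) + 1; have m0 : 0 < m by rewrite /m; lra.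
have d3 : 0 < d / 3 by rewrite divr_gt0.
have e0 : 0 < d / 3 / m by exact: divr_gt0.
have near1 : \forall i \near F, [/\ admissible (h i) (l i), l i < l0 + 1 &
    `|suppf (h i) (l i) w - suppf h0 l0 w| < d / 3].
  have /cvgrPdist_lt/(_ 1 ltr01) := lF => nl.
  apply: filterS3 admF nl (support_cvg_pointwise w adm0 admF hF lF d3) =>
    i admi li wi; split => //.
  by move: li; rewrite distrC => /(le_lt_trans (ler_norm _)); lra.
exists ([set w' | enorm (w' - w) < d / 3 / m],
  [set i | [/\ admissible (h i) (l i), l i < l0 + 1 &
    `|suppf (h i) (l i) w - suppf h0 l0 w| < d / 3]]).
  by split => //=; exact: enorm_near.
move=> [w' i] [/= w'w [admi li Si]].
have w'w3 : m * enorm (w' - w) < d / 3 by rewrite mulrC -ltr_pdivlMr.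
have [li0 _ _] := admi.
have n0 := enorm_ge0 (w' - w).
have a1 := support_lipschitz admi w' w; have a2 := support_lipschitz admi w w'.
have b1 := support_lipschitz adm0 w' w; have b2 := support_lipschitz adm0 w w'.
move: a1 a2 b1 b2; rewrite (enormB w w') => a1 a2 b1 b2.
have c1 : 2 * l i * enorm (w' - w) <= m * enorm (w' - w).
  by rewrite ler_wpM2r// /m; lra.
have c2 : 2 * l0 * enorm (w' - w) <= m * enorm (w' - w).
  by rewrite ler_wpM2r// /m; lra.
rewrite /P; move: Si; rewrite ltr_norml ler_norml => /andP[s1 s2].
apply/andP; split; lra.
Qed.

End SupportConvergence.

(** * Limits within a subset and in Euclidean norm *)

Lemma cvg_within_map (X Y : topologicalType) (A : set X) (B : set Y)
    (g : X -> Y) (x : X) :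
  g @ x --> g x -> (forall z, A z -> B (g z)) ->
  g @ within A (nbhs x) --> within B (nbhs (g x)).
Proof.
move=> cg AB D; rewrite /within/= => nD.
have := cg _ nD; rewrite /= /nbhs/=; apply: filterS => z; rewrite /= => h Az.
by apply: h; exact: AB.
Qed.

Lemma cvg_enorm (R : realType) (n : nat) (T : Type) (F : set_system T)
    (f : T -> 'rV[R]_n) (v : 'rV[R]_n) : Filter F ->
  (forall e : R, 0 < e -> \forall t \near F, enorm (f t - v) < e) ->
  f @ F --> v.
Proof.
move=> FF hf; apply/cvg_ballP => e e0; apply: filterS (hf e e0) => t fe.
split=> // i j; rewrite (ord1 i) /ball/= distrC.
by apply: le_lt_trans fe; have := coord_le_enorm (f t - v) j; rewrite !mxE.
Qed.

(** * Conjugates of the Hamiltonian and almost-everywhere bounds *)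

Section Hamiltonian.
Context {R : realType} {N : nat}.
Variables (H : R -> 'rV[R]_N -> 'rV[R]_N -> R) (T : R).

Lemma Hstar_leP t x v b :
  (Hstar H t x v <= b%:E)%E <-> (forall p, dot v p - H t x p <= b).
Proof.
split=> [h p|h].
  by rewrite -lee_fin; apply: le_trans h; apply: ereal_sup_ubound; exists p.
by apply: ge_ereal_sup => _ [p _ <-]; rewrite lee_fin.
Qed.

(** Only an upper bound is at stake: the value at [p = 0] keeps the conjugate above minus
    infinity. *)
Lemma domHstar_le t x v b :
  (forall p, dot v p - H t x p <= b) -> domHstar H t x v.
Proof.
move=> /Hstar_leP h; rewrite /domHstar/= fin_numE; apply/andP; split.
  rewrite gt_eqF//; apply: (@lt_le_trans _ _ (dot v 0 - H t x 0)%:E).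
    exact: ltNyr.
  by apply: ereal_sup_ubound; exists 0.
by rewrite lt_eqF// (le_lt_trans h)// ltry.
Qed.

(** Points of the body project into the domain of the conjugate, where [lam] bounds slope and
    height. For duality, the slope of an approximate affine minorant is lifted to its conjugate
    value, which is at most [b] and at most [lam t x]. *)
Lemma conditionA_admissible lam t x : H2 H T -> H3 H T ->
  (forall t x, 0 <= lam t x) ->
  (forall t x, tint T t -> forall v, domHstar H t x v -> enorm v <= lam t x) ->
  (forall t x, tint T t -> forall v, domHstar H t x v ->
        (`|Hstar H t x v| <= (lam t x)%:E)%E) ->
  tint T t -> admissible (H t x) (lam t x).
Proof.
move=> h2 h3 lam0 dlam Hlam tT; split => //.
- move=> k [hk kl]; have dk := domHstar_le hk.
  split; first exact: dlam.
  have := Hlam t x tT _ dk; rewrite -(fineK dk) /= lee_fin => hf.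
  have : fine (Hstar H t x (tl k)) <= hd k.
    by rewrite -lee_fin fineK//; exact/Hstar_leP.
  move: hf; rewrite !ler_norml => /andP[f1 f2] f3; lra.
move=> q e e0; have [C [C0 hC]] := h3 (enorm x) (enorm_ge0 x).
have [||v [b [vb hq]]] := @affine_minorant_approx R N (H t x) C q e _ _ e0.
- by move=> p p' s hs; exact: h2.
- by move=> p p'; apply: hC => //; rewrite /cball/=.
have dv := domHstar_le vb.
exists (pack (fine (Hstar H t x v)) v).
  split; rewrite hd_pack ?tl_pack.
    by apply/Hstar_leP; rewrite fineK.
  have := Hlam t x tT _ dv; rewrite -(fineK dv) /= lee_fin.
  exact/le_trans/ler_norm.
rewrite hd_pack tl_pack; apply: (le_trans hq); rewrite lerD2l lerN2.
by rewrite -lee_fin fineK//; exact/Hstar_leP.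
Qed.

Lemma ae_onS2 (P Q S : R -> Prop) :
  (forall t, tint T t -> P t -> Q t -> S t) ->
  ae_on T P -> ae_on T Q -> ae_on T S.
Proof.
move=> PQS; apply: (@filterS2 _ _ (ae_filter_ringOfSetsType lebesgue_measure)).
by move=> t Pt Qt tT; exact: PQS (Pt tT) (Qt tT).
Qed.

Lemma integrable_nonneg_comb (a b : R) (f g : R -> R) : 0 <= a -> 0 <= b ->
  integrable_nonneg T f -> integrable_nonneg T g ->
  integrable_nonneg T (fun t => a * f t + b * g t).
Proof.
move=> a0 b0 [f0 fi] [g0 gi]; split.
  by move=> t tT; rewrite addr_ge0// mulr_ge0 ?f0 ?g0.
have mT : measurable (tint T).
  have -> : tint T = `[0, T]%classic; last exact: measurable_itv.
  by apply/seteqP; split => t; rewrite /tint/= in_itv/=.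
have -> : EFin \o (fun t => a * f t + b * g t) =
  (fun t => a%:E * (EFin \o f) t + b%:E * (EFin \o g) t)%E by [].
by apply: integrableD => //; exact: integrableZl.
Qed.

End Hamiltonian.

(** * Representation by parametrised truncated epigraphs *)

Theorem theorem3p1 (R : realType) (N : nat) (T : R)
    (H : R -> 'rV[R]_N -> 'rV[R]_N -> R) :
  conditionA H T ->
  exists (f : R -> 'rV[R]_N -> 'rV[R]_N.+1 -> 'rV[R]_N)
         (l : R -> 'rV[R]_N -> 'rV[R]_N.+1 -> R),
    (* representation formula, B = closed unit ball of R^(N+1) *)
    (forall t x p, tint T t ->
       (H t x p)%:E =
       ereal_sup [set ((dot p (f t x a) - l t x a)%:E) | a in cball 1]) /\
    (* (R1) continuity on [0,T] x R^N x B *)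
    {within [set z : R * 'rV[R]_N * 'rV[R]_N.+1 | tint T z.1.1 /\ cball 1 z.2],
       continuous (fun z : R * 'rV[R]_N * 'rV[R]_N.+1 => f z.1.1 z.1.2 z.2)} /\
    {within [set z : R * 'rV[R]_N * 'rV[R]_N.+1 | tint T z.1.1 /\ cball 1 z.2],
       continuous (fun z : R * 'rV[R]_N * 'rV[R]_N.+1 => l z.1.1 z.1.2 z.2)} /\
    (* (R2) *)
    (forall r : R, 0 <= r -> exists K : R -> R, integrable_nonneg T K /\
       ae_on T (fun t => forall x y a, cball r x -> cball r y -> cball 1 a ->
         enorm (f t x a - f t y a) + `|l t x a - l t y a| <= K t * enorm (x - y))) /\
    (* (R3) *)
    (exists C : R -> R, integrable_nonneg T C /\
       ae_on T (fun t => forall x a, cball 1 a ->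
         enorm (f t x a) + `|l t x a| <= C t * (1 + enorm x))).
Proof.
move=> [h1 [h2 [h3 [_ [h5 [lam [clam [lam0 [dlam [Hlam [lipl growl]]]]]]]]]]].
have [sel [C [C0 hsel]]] := convex_body_selection R N.+1.
have adm t x (tT : tint T t) := conditionA_admissible x h2 h3 lam0 dlam Hlam tT.
pose S t x := suppf (H t x) (lam t x).
(* The unit ball is stretched to radius [2 * lam t x], which covers the body; [f] and [l] will be
   the tail and head of the selected point [e]. *)
pose y t x (a : 'rV[R]_N.+1) := (2 * lam t x) *: a.
pose e t x a := sel (S t x) (y t x a).
have subS t x : tint T t -> sublinear_bounded (S t x) (2 * lam t x).
  by move=> tT; exact/support_sublinear/adm.
have e_in t x a w : tint T t -> dot (e t x a) w <= S t x w.
  by move=> tT; have [+ _ _] := hsel _ _ (subS t x tT); exact.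
have e_fix t x a : tint T t -> (forall w, dot (y t x a) w <= S t x w) ->
    e t x a = y t x a.
  by move=> tT; have [_ + _] := hsel _ _ (subS t x tT); exact.
have e_cmp t x a t' x' a' d : tint T t -> tint T t' -> 0 <= d ->
    (forall w, `|S t x w - S t' x' w| <= d * enorm w) ->
    enorm (e t x a - e t' x' a') <= C * (d + enorm (y t x a - y t' x' a')).
  move=> tT tT' d0 SS'; have [_ _] := hsel _ _ (subS t x tT).
  by apply => //; exact: subS.
have e_le t x a : tint T t -> enorm (e t x a) <= 2 * lam t x.
  move=> tT; have h := e_in t x a (e t x a) tT.
  have [_ _ /(_ (e t x a)) h'] := subS t x tT.
  have := le_trans h (le_trans (ler_norm _) h'); rewrite enorm_sqr expr2.
  have [->|a0] := eqVneq (enorm (e t x a)) 0; first by rewrite mulr_ge0.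
  by rewrite ler_pM2r// lt0r a0 enorm_ge0.
(* Joint continuity: near [z0] the support functions converge uniformly and [y] is continuous, while
   [sel] is Lipschitz in both. *)
have e_near (z0 : R * 'rV[R]_N * 'rV[R]_N.+1) (d : R) : tint T z0.1.1 -> 0 < d ->
    \forall z \near within [set z : R * 'rV[R]_N * 'rV[R]_N.+1 |
        tint T z.1.1 /\ cball 1 z.2] (nbhs z0),
      enorm (e z.1.1 z.1.2 z.2 - e z0.1.1 z0.1.2 z0.2) < d.
  move=> tT d0; set D := [set z | _]; set F := within D (nbhs z0).
  have FF : Filter F by exact: within_filter.
  have DF : F D by apply: filterS (@filterT _ (nbhs z0) _).
  have c2 : z.2 @[z --> z0] --> z0.2.
    exact: (@cvg_snd _ _ (nbhs z0.1) (nbhs z0.2)).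
  have c1 : z.1 @[z --> z0] --> z0.1.
    exact: (@cvg_fst _ _ (nbhs z0.1) (nbhs z0.2)).
  have c11 : z.1.1 @[z --> z0] --> z0.1.1.
    apply: (cvg_comp _ _ c1).
    exact: (@cvg_fst _ _ (nbhs z0.1.1) (nbhs z0.1.2)).
  have c12 : z.1.2 @[z --> z0] --> z0.1.2.
    apply: (cvg_comp _ _ c1).
    exact: (@cvg_snd _ _ (nbhs z0.1.1) (nbhs z0.1.2)).
  have hF p : H z.1.1 z.1.2 p @[z --> F] --> H z0.1.1 z0.1.2 p.
    have /subspace_continuousP/(_ (z0.1.1, z0.1.2, p) tT) cH := h1.
    pose g (z : R * 'rV[R]_N * 'rV[R]_N.+1) : R * 'rV[R]_N * 'rV[R]_N :=
      (z.1.1, z.1.2, p).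
    apply: (@cvg_comp _ _ _ g _ F _ _ _ cH).
    apply: (@cvg_within_map _ _ D _ g) => [|z []//].
    apply: (@cvg_pair _ _ _ (nbhs z0) (nbhs (z0.1.1, z0.1.2)) (nbhs p)).
      exact: (@cvg_pair _ _ _ (nbhs z0) (nbhs z0.1.1) (nbhs z0.1.2)).
    exact: cvg_cst.
  have lF : lam z.1.1 z.1.2 @[z --> F] --> lam z0.1.1 z0.1.2.
    have /subspace_continuousP/(_ (z0.1.1, z0.1.2) tT) cl := clam.
    pose g (z : R * 'rV[R]_N * 'rV[R]_N.+1) : R * 'rV[R]_N := (z.1.1, z.1.2).
    apply: (@cvg_comp _ _ _ g _ F _ _ _ cl).
    apply: (@cvg_within_map _ _ D _ g) => [|z []//].
    exact: (@cvg_pair _ _ _ (nbhs z0) (nbhs z0.1.1) (nbhs z0.1.2)).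
  have C1 : 0 < C + 1 by rewrite ltr_wpDl.
  (* Chosen so that [C * (d' + d') < d], even when [C = 0]. *)
  pose d' := d / (C + 1) / 2.
  have d'0 : 0 < d' by rewrite !divr_gt0.
  have admF : \forall z \near F, admissible (H z.1.1 z.1.2) (lam z.1.1 z.1.2).
    by apply: filterS DF => z [tz _]; exact: adm.
  have nS := support_cvg_uniform (adm _ z0.1.2 tT) admF hF lF d'0.
  have ny : \forall z \near F,
      enorm (y z.1.1 z.1.2 z.2 - y z0.1.1 z0.1.2 z0.2) < d'.
    have l1 : 0 < lam z0.1.1 z0.1.2 + 1 by rewrite ltr_wpDl.
    have d4 : 0 < d' / 4 by rewrite divr_gt0.
    have dl : 0 < d' / 4 / (lam z0.1.1 z0.1.2 + 1) by rewrite divr_gt0.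
    have na : \forall z \near F,
        enorm (z.2 - z0.2) < d' / 4 / (lam z0.1.1 z0.1.2 + 1).
      have na0 : \forall z \near z0,
          enorm (z.2 - z0.2) < d' / 4 / (lam z0.1.1 z0.1.2 + 1).
        exact: c2 (enorm_near _ dl).
      by apply: filterS na0 => z + _.
    have /cvgrPdist_lt/(_ _ d4) nl := lF.
    apply: filterS3 DF nl na => z [_ z1] lz az.
    rewrite /y; set L := lam z.1.1 _; set L0 := lam z0.1.1 _.
    have -> : (2 * L) *: z.2 - (2 * L0) *: z0.2 =
        (2 * (L - L0)) *: z.2 + (2 * L0) *: (z.2 - z0.2).
      by rewrite mulrBr scalerBl scalerBr addrA subrK.
    apply: (le_lt_trans (enormD _ _)).
    rewrite !enormZ (ger0_norm (_ : 0 <= 2 * L0)) ?mulr_ge0 ?lam0//.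
    rewrite normrM ger0_norm// distrC.
    have b1 : 2 * `|L0 - L| * enorm z.2 <= 2 * `|L0 - L|.
      by rewrite -[leRHS]mulr1 ler_wpM2l.
    have b2 : L0 * enorm (z.2 - z0.2) <= (L0 + 1) * enorm (z.2 - z0.2).
      by rewrite ler_wpM2r ?enorm_ge0// lerDl.
    have b3 : (L0 + 1) * enorm (z.2 - z0.2) < d' / 4.
      by rewrite mulrC -ltr_pdivlMr.
    apply: (@lt_le_trans _ _ (2 * (d' / 4) + 2 * (d' / 4))); last by lra.
    apply: ltr_leD; first by rewrite (le_lt_trans b1)// ltr_pM2l.
    by rewrite -mulrA ler_pM2l// (le_trans b2)// ltW.
  apply: filterS3 DF (nS FF) ny => z [tz _] Sz yz.
  apply: (le_lt_trans (e_cmp _ _ _ _ _ _ _ tz tT (ltW d'0) Sz)).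
  apply: (@le_lt_trans _ _ (C * (d' + d'))).
    by rewrite ler_wpM2l// lerD2l ltW.
  have -> : d' + d' = d / (C + 1) by rewrite /d'; field; rewrite gt_eqF.
  by rewrite mulrA ltr_pdivrMr// mulrC ltr_pM2l// ltrDl.
exists (fun t x a => tl (e t x a)), (fun t x a => hd (e t x a)).
split; [|split; [|split; [|split]]].
- move=> t x p tT; apply/eqP; rewrite eq_le; apply/andP; split.
    (* A near-optimal point [k] of the body equals [y t x a] for some [a], and the selection fixes
       it. *)
    apply/lee_addgt0Pr => d d0; rewrite -leeBlDr//.
    have [_ bnd /(_ p d d0)[k bk hk]] := adm t x tT.
    have := enorm_body (adm t x tT) bk => kle.
    have [a a1 yk] : exists2 a, cball 1 a & y t x a = k.
      have [l0|l0] := eqVneq (lam t x) 0.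
        exists 0; first by rewrite /cball/= enorm0.
        rewrite /y scaler0; apply/esym/enorm0_eq0/eqP.
        by rewrite eq_le enorm_ge0 andbT (le_trans kle)// l0 mulr0.
      have l2 : 0 < 2 * lam t x by rewrite mulr_gt0// lt0r l0 lam0.
      exists ((2 * lam t x)^-1 *: k); last first.
        by rewrite /y scalerA mulfV ?gt_eqF// scale1r.
      rewrite /cball/= enormZ gtr0_norm ?invr_gt0// mulrC.
      by rewrite ler_pdivrMr// mul1r.
    have ek : e t x a = k.
      rewrite e_fix// yk => // w; rewrite dotC.
      exact: dot_le_support (adm t x tT) _ _ bk.
    apply: (@le_trans _ _ (dot p (tl (e t x a)) - hd (e t x a))%:E).
      by rewrite ek -EFinB lee_fin.
    by apply: ereal_sup_ubound; exists a.
  apply: ge_ereal_sup => _ [a a1 <-]; rewrite lee_fin.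
  (* Conversely [e] lies in the body, whose support function at [(-1, p)] is [H t x p]. *)
  have := e_in t x a (pack (-1) p) tT.
  have := support_perspective (adm t x tT) p ltr01.
  rewrite invr1 scale1r mul1r /S => ->.
  by rewrite dotS hd_pack tl_pack mulrN1 addrC dotC.
- apply/subspace_continuousP => z0 [tT a1]; apply: cvg_enorm => d d0.
  apply: filterS (e_near z0 d tT d0) => z; apply: le_lt_trans.
  by rewrite -tlB tl_le.
- apply/subspace_continuousP => z0 [tT a1]; apply/cvgrPdist_lt => d d0.
  apply: filterS (e_near z0 d tT d0) => z; apply: le_lt_trans.
  by rewrite distrC -hdB hd_le.
- move=> r r0; have [k [kint kae]] := h5 r r0; have [zeta [zint zae]] := lipl r r0.
  (* The support functions differ by [2 * k + zeta] and [y] by [2 * zeta], per unit of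
     [enorm (x - x')]; the sum is multiplied by [C] and doubled to count both [f] and [l]. *)
  exists (fun t => (4 * C) * k t + (6 * C) * zeta t); split.
    by apply: integrable_nonneg_comb => //; rewrite mulr_ge0.
  move: kae zae; apply: ae_onS2 => t tT kt zt x x' a xr x'r a1.
  have [k0 _] := kint; have [z0 _] := zint.
  have n0 := enorm_ge0 (x - x').
  have kn : 0 <= k t * enorm (x - x') by rewrite mulr_ge0// k0.
  have zn : 0 <= zeta t * enorm (x - x') by rewrite mulr_ge0// z0.
  pose d := 2 * (k t * enorm (x - x')) + zeta t * enorm (x - x').
  have SS' : forall w, `|S t x w - S t x' w| <= d * enorm w.
    apply: support_compare => //; [exact: adm|exact: adm| |exact: zt].
    by move=> p; rewrite mulrAC; exact: kt.
  have d0 : 0 <= d by rewrite addr_ge0// mulr_ge0.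
  have yy : enorm (y t x a - y t x' a) <= 2 * (zeta t * enorm (x - x')).
    rewrite /y -scalerBl -mulrBr enormZ normrM ger0_norm// -mulrA ler_wpM2l//.
    apply: le_trans (zt x x' xr x'r); rewrite -[leRHS]mulr1.
    by rewrite ler_wpM2l.
  have := e_cmp t x a t x' a d tT tT d0 SS'.
  move=> /le_trans/(_ (ler_wpM2l C0 (lerD (lexx d) yy))) ee.
  apply: (@le_trans _ _ (enorm (e t x a - e t x' a) + enorm (e t x a - e t x' a))).
    by rewrite -tlB -hdB lerD ?tl_le ?hd_le.
  apply: (le_trans (lerD ee ee)); rewrite /d; lra.
have [theta [tint_ tae]] := growl.
(* One [2 * theta t] for [f] and one for [l], each at most [enorm e <= 2 * lam t x]. *)
exists (fun t => 2 * theta t + 2 * theta t); split.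
  by apply: integrable_nonneg_comb.
move: (tae) (tae); apply: ae_onS2 => t tT tht _ x a a1.
apply: (@le_trans _ _ (enorm (e t x a) + enorm (e t x a))).
  by rewrite lerD ?tl_le ?hd_le.
have := tht x; have := e_le t x a tT; lra.
Qed.
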